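(* Let $A\in\mathbb{R}^{n\times n}$ be a nonnegative, irreducible, diagonally symmetrizable matrix with null diagonal, let $\delta_i=\sum_{j=1}^n a_{ij}$, $\Delta=\mathrm{diag}\{\delta_1,\dots,\delta_n\}$, $H_1=\Delta^{-1}A$ and $\pi>1$, and let $\psi(x)=[\psi_1(x_1)\,\cdots\,\psi_n(x_n)]^T$, where each $\psi_i:\mathbb{R}\to\mathbb{R}$ satisfies (A.1)–(A.4) below and $\psi_i(\xi)=\psi_j(\xi)$ for all $i,j$ and all $\xi\in\mathbb{R}$. Let $x^+$ be the nonzero equilibrium point in $\mathbb{R}^n_+$ of the system $$\dot x=\Delta\left[-x+\pi H_1\psi(x)\right],\qquad x\in\mathbb{R}^n.$$ If the system admits an equilibrium point $\bar x\in\mathcal{K}$, where $\mathcal{K}$ is an orthant of $\mathbb{R}^n$ and $\mathcal{K}\neq\mathbb{R}^n_+,\mathbb{R}^n_-$, then $\|\bar x\|\le\|x^+\|$.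
   Context: A matrix $A\in\mathbb{R}^{n\times n}$ is (diagonally) symmetrizable if $DA$ is symmetric for some diagonal matrix $D$ with positive diagonal entries. An irreducible matrix with null diagonal has $n\ge 2$ (the $1\times1$ zero matrix is reducible), so all $\delta_i>0$. Each $\psi_i$ is continuously differentiable and satisfies: (A.1) $\psi_i(-x_i)=-\psi_i(x_i)$ for all $x_i\in\mathbb{R}$; (A.2) $\frac{\partial\psi_i}{\partial x_i}(x_i)>0$ for all $x_i\in\mathbb{R}$ and $\frac{\partial\psi_i}{\partial x_i}(0)=1$; (A.3) $\lim_{x_i\to\pm\infty}\psi_i(x_i)=\pm1$; (A.4) $\psi_i$ is strictly convex for $x_i<0$ and strictly concave for $x_i>0$. An orthant is a set $\mathcal{K}=\{x\in\mathbb{R}^n: k_ix_i\ge0,\ i=1,\dots,n\}$ with $k_i\in\{\pm1\}$; $\mathbb{R}^n_+$ and $\mathbb{R}^n_-$ are the orthants with all $k_i=1$ and all $k_i=-1$, respectively. For $\pi>1$ it is known that the system has exactly one nonzero equilibrium in $\mathbb{R}^n_+$, denoted $x^+$. $\|\cdot\|$ is the Euclidean norm. *)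

(* Defs.v *)
From HB Require Import structures.
From mathcomp Require Import all_boot all_order all_algebra perm.
From mathcomp Require Import all_classical all_reals all_analysis.

Set Implicit Arguments.
Unset Strict Implicit.
Unset Printing Implicit Defensive.

Import Order.TTheory GRing.Theory Num.Theory numFieldNormedType.Exports.

Local Open Scope classical_set_scope.
Local Open Scope ring_scope.

Definition nonneg_mx (R : realType) (n : nat) (A : 'M[R]_n) : Prop :=
  forall i j, 0 <= A i j.

Definition null_diagonal (R : realType) (n : nat) (A : 'M[R]_n) : Prop :=
  forall i, A i i = 0.

(* Conjugating A by a permutation matrix gives [B C; 0 D] with B square of
   size r, 0 < r < n: [row_perm s (col_perm s A) i j] is [A (s i) (s j)].
   In size at most 1 no such block form exists, and by convention the zero
   matrix is reducible there. *)
Definition reducible_mx (R : realType) (n : nat) (A : 'M[R]_n) : Prop :=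
  ((n <= 1)%N /\ A = 0) \/
  exists (s : 'S_n) (r : nat), (0 < r < n)%N /\
    forall i j : 'I_n, (r <= i)%N -> (j < r)%N ->
      row_perm s (col_perm s A) i j = 0.

Definition irreducible_mx (R : realType) (n : nat) (A : 'M[R]_n) : Prop :=
  ~ reducible_mx A.

Definition diag_symmetrizable (R : realType) (n : nat) (A : 'M[R]_n) : Prop :=
  exists d : 'rV[R]_n, (forall i, 0 < d 0 i) /\
    (diag_mx d *m A)^T = diag_mx d *m A.

Definition Delta (R : realType) (n : nat) (A : 'M[R]_n) : 'M[R]_n :=
  diag_mx (\row_i \sum_(j < n) A i j).

Definition H1 (R : realType) (n : nat) (A : 'M[R]_n) : 'M[R]_n :=
  invmx (Delta A) *m A.

Definition continuously_differentiable (R : realType) (f : R -> R) : Prop :=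
  (forall x, derivable f x 1) /\ continuous (derive1 f).

Definition strictly_convex_on (R : realType) (D : set R) (f : R -> R) : Prop :=
  forall x y t, D x -> D y -> x != y -> 0 < t < 1 ->
    f (t * x + (1 - t) * y) < t * f x + (1 - t) * f y.

Definition strictly_concave_on (R : realType) (D : set R) (f : R -> R) : Prop :=
  forall x y t, D x -> D y -> x != y -> 0 < t < 1 ->
    t * f x + (1 - t) * f y < f (t * x + (1 - t) * y).

Record sigmoidal (R : realType) (f : R -> R) : Prop := Sigmoidal {
  sigmoidal_C1 : continuously_differentiable f ;
  sigmoidal_odd : forall x, f (- x) = - f x ;
  sigmoidal_deriv_gt0 : forall x, 0 < derive1 f x ;
  sigmoidal_deriv0 : derive1 f 0 = 1 ;
  sigmoidal_cvg_pinfty : f x @[x --> +oo] --> (1 : R) ;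
  sigmoidal_cvg_ninfty : f x @[x --> -oo] --> (- 1 : R) ;
  sigmoidal_convex : strictly_convex_on [set x | x < 0] f ;
  sigmoidal_concave : strictly_concave_on [set x | 0 < x] f }.

Definition psi_vec (R : realType) (n : nat) (psi : 'I_n -> R -> R)
    (x : 'cV[R]_n) : 'cV[R]_n :=
  \col_i psi i (x i 0).

Definition vector_field (R : realType) (n : nat) (A : 'M[R]_n)
    (pi_ : R) (psi : 'I_n -> R -> R) (x : 'cV[R]_n) : 'cV[R]_n :=
  Delta A *m (- x + pi_ *: (H1 A *m psi_vec psi x)).

Definition equilibrium (R : realType) (n : nat)
    (F : 'cV[R]_n -> 'cV[R]_n) (x : 'cV[R]_n) : Prop :=
  F x = 0.

Definition orthant_of (R : realType) (n : nat) (k : 'I_n -> R) : set 'cV[R]_n :=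
  [set x | forall i, 0 <= k i * x i 0].

Definition is_orthant (R : realType) (n : nat) (K : set 'cV[R]_n) : Prop :=
  exists k : 'I_n -> R, (forall i, k i = 1 \/ k i = -1) /\ K = orthant_of k.

Definition pos_orthant (R : realType) (n : nat) : set 'cV[R]_n :=
  orthant_of (fun=> 1).

Definition neg_orthant (R : realType) (n : nat) : set 'cV[R]_n :=
  orthant_of (fun=> -1).

(* The library norm on matrices is the maximum norm, hence this definition. *)
Definition euclidean_norm (R : realType) (n : nat) (x : 'cV[R]_n) : R :=
  Num.sqrt (\sum_(i < n) x i 0 ^+ 2).

(* Main.v *)
(* Write f for the common activation function. At an equilibrium x,
   delta_i x_i = pi sum_j a_ij f(x_j), so x_i is pi times a weighted mean of the
   f(x_j). Since f is odd and increasing, M = max_i |xbar_i| satisfies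
   M <= pi f(M), while m = min_i x+_i satisfies pi f(m) <= m, and m > 0 by
   irreducibility. Concavity makes f(t)/t strictly decreasing for t > 0, which
   forces M <= m. Hence |xbar_i| <= x+_i for every i. *)
Require Import Defs.
From HB Require Import structures.
From mathcomp Require Import all_boot all_order all_algebra perm.
From mathcomp Require Import all_classical all_reals all_analysis.
From mathcomp Require Import ring lra.

Set Implicit Arguments.
Unset Strict Implicit.
Unset Printing Implicit Defensive.

Import Order.TTheory GRing.Theory Num.Theory numFieldNormedType.Exports.

Local Open Scope classical_set_scope.
Local Open Scope ring_scope.

(** Listing the complement of [Z] first and [Z] last gives the permutation: rows of index at least
    [#|~: Z|] then lie in [Z] and columns below it outside [Z]. The elements [p] and [q] make both
    blocks nonempty. *)
Lemma reducible_closed_set (R : realType) (n : nat) (A : 'M[R]_n)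
    (Z : {set 'I_n}) (p q : 'I_n) :
  p \in Z -> q \notin Z ->
  (forall i j, i \in Z -> j \notin Z -> A i j = 0) -> reducible_mx A.
Proof.
move=> pZ qZ AZ; right.
have cZ : (#|Z| + #|~: Z| = n)%N by rewrite cardsC card_ord.
pose l := enum (~: Z) ++ enum Z.
have szl : size l = n.
  by rewrite size_cat -!cardE addnC.
have ul : uniq l.
  rewrite cat_uniq !enum_uniq /= andbT; apply/hasPn => x.
  by rewrite !mem_enum inE negbK.
have fI : injective (fun i : 'I_n => nth p l i).
  move=> i j /eqP; rewrite nth_uniq ?szl // => /eqP.
  exact: ord_inj.
exists (perm fI), #|~: Z|; split.
  apply/andP; split; first by apply/card_gt0P; exists q; rewrite inE.
  rewrite -[ltnRHS]cZ -[ltnLHS]add0n ltn_add2r.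
  by apply/card_gt0P; exists p.
move=> i j ri jr; rewrite !mxE !permE; apply: AZ.
  rewrite nth_cat -cardE ltnNge ri /= -mem_enum mem_nth // -cardE.
  by rewrite ltn_subLR // addnC cZ.
rewrite nth_cat -cardE jr.
have /(mem_nth p) : (j < size (enum (~: Z)))%N by rewrite -cardE.
by rewrite mem_enum inE.
Qed.

(** A zero row [i] would make [[set i]] a closed set. If [i] is the only index, the null diagonal
    gives [A = 0] in size one, which is reducible by convention. *)
Lemma irreducible_row_sum_gt0 (R : realType) (n : nat) (A : 'M[R]_n) (i : 'I_n) :
  nonneg_mx A -> null_diagonal A -> irreducible_mx A ->
  0 < \sum_(j < n) A i j.
Proof.
move=> A0 dA irA; rewrite lt_def sumr_ge0 ?andbT//.
apply/eqP => /eqP; rewrite psumr_eq0// => /allP Ai0.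
have {}Ai0 j : A i j = 0 by apply/eqP/Ai0; rewrite mem_index_enum.
apply: irA; have [[j ij]|ni] := pselect (exists j, j != i).
  apply: (@reducible_closed_set _ _ _ [set i] i j); rewrite ?inE//.
  by move=> a b; rewrite !inE => /eqP-> _.
have all_i j : j = i by apply/eqP/negPn/negP => ji; apply: ni; exists j.
left; split; last by apply/matrixP => a b; rewrite (all_i a) (all_i b) dA mxE.
rewrite -[n]card_ord; apply/card_le1P => a _ b.
by rewrite !inE (all_i a) (all_i b) eqxx.
Qed.

(** Positive row sums make [Delta A] invertible, so it cancels against the inverse inside [H1 A]. *)
Lemma equilibriumE (R : realType) (n : nat) (A : 'M[R]_n) (pi_ : R)
    (psi : 'I_n -> R -> R) (x : 'cV[R]_n) :
  (forall i, 0 < \sum_(j < n) A i j) ->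
  equilibrium (vector_field A pi_ psi) x ->
  forall i, (\sum_(j < n) A i j) * x i 0 =
    pi_ * \sum_(j < n) A i j * psi j (x j 0).
Proof.
move=> d0; have Du : Delta A \in unitmx.
  rewrite unitmxE det_diag unitfE; apply/prodf_neq0 => i _.
  by rewrite mxE gt_eqF.
rewrite /equilibrium /vector_field /H1 mulmxDr mulmxN -scalemxAr.
rewrite !mulmxA mulmxV// mul1mx addrC => /eqP.
rewrite subr_eq0 => /eqP/colP E i; have := E i.
rewrite /Delta mul_diag_mx !mxE => <-; congr (_ * _).
by apply: eq_bigr => j _; rewrite mxE.
Qed.

Section Sigmoidal.
Variables (R : realType) (f : R -> R).
Hypothesis sf : sigmoidal f.

Lemma sigmoidal0 : f 0 = 0.
Proof. by have := sigmoidal_odd sf 0; rewrite oppr0; lra. Qed.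

Lemma sigmoidal_lt : {homo f : x y / x < y}.
Proof.
have [df _] := sigmoidal_C1 sf; move=> x y xy.
apply: (@gtr0_derive1_lt_cc _ _ x y) => //.
- by move=> z _; exact: sigmoidal_deriv_gt0.
- apply: continuous_subspaceT => z.
  exact/differentiable_continuous/derivable1_diffP.
- by rewrite in_itv /= lexx ltW.
- by rewrite in_itv /= lexx ltW.
Qed.

Lemma sigmoidal_le : {homo f : x y / x <= y}.
Proof. exact: (ltW_homo sigmoidal_lt). Qed.

Lemma sigmoidal_gt0 x : 0 < x -> 0 < f x.
Proof. by move=> /sigmoidal_lt; rewrite sigmoidal0. Qed.

Lemma sigmoidal_norm x : `|f x| = f `|x|.
Proof.
have [x0|x0] := leP 0 x.
  by rewrite (ger0_norm x0) ger0_norm// -sigmoidal0 sigmoidal_le.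
by rewrite (ltr0_norm x0) (sigmoidal_odd sf) ltr0_norm// -sigmoidal0 sigmoidal_lt.
Qed.

(** Strict concavity at [x], seen as the combination of [e] and [y] with weight [(y - x) / (y - e)]
    on [e], with denominators cleared. *)
Lemma sigmoidal_concave_between e x y : 0 < e -> e < x -> x < y ->
  (y - x) * f e + (x - e) * f y < (y - e) * f x.
Proof.
move=> e0 ex xy; have ye : 0 < y - e by lra.
have yeN0 : y - e != 0 by rewrite gt_eqF.
have := sigmoidal_concave sf (x := e) (y := y) (t := (y - x) / (y - e)).
have -> : 1 - (y - x) / (y - e) = (x - e) / (y - e) by field.
have -> : (y - x) / (y - e) * e + (x - e) / (y - e) * y = x by field.
have -> : (y - x) / (y - e) * f e + (x - e) / (y - e) * f y =
  ((y - x) * f e + (x - e) * f y) / (y - e) by field.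
rewrite (ltr_pdivrMr (f x) _ ye) [f x * _]mulrC; apply => //=.
- by lra.
- by rewrite lt_eqF//; lra.
- by rewrite divr_gt0 ?ltr_pdivrMr//; lra.
Qed.

Lemma sigmoidal_slope_le x y : 0 < x -> x < y -> x * f y <= y * f x.
Proof.
(* Concavity is only available on the open half-line, so 0 is replaced by a
   small e > 0; f e > 0 makes the resulting inequality usable without a limit. *)
move=> x0 xy; have fxy := sigmoidal_lt xy; rewrite leNgt; apply/negP => xfy.
pose D := x * f y - y * f x; pose S := f y - f x.
have D0 : 0 < D by rewrite subr_gt0.
have S0 : 0 < S by rewrite subr_gt0.
(* Concavity between [e] and [y] rearranges to [(y - x) * f e + D < e * S], which [e * S <= D]
   contradicts. The bound [x / 2] keeps [e] below [x]. *)
pose e := Num.min (x / 2) (D / S).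
have e0 : 0 < e by rewrite lt_min !divr_gt0.
have ex : e < x by rewrite gt_min; apply/orP; left; lra.
have eD : e * S <= D by rewrite -ler_pdivlMr// ge_min lexx orbT.
have := sigmoidal_concave_between e0 ex xy.
have : 0 < (y - x) * f e by rewrite mulr_gt0 ?sigmoidal_gt0// subr_gt0.
move: eD; rewrite /D /S; nra.
Qed.

(** The weak inequality between [x / 2] and [y] becomes strict at [x] by strict concavity on the
    segment from [x / 2] to [y]. *)
Lemma sigmoidal_slope_lt x y : 0 < x -> x < y -> x * f y < y * f x.
Proof.
move=> x0 xy; have y0 := lt_trans x0 xy.
have e0 : 0 < x / 2 by lra.
have ex : x / 2 < x by lra.
have := sigmoidal_concave_between e0 ex xy.
have := sigmoidal_slope_le e0 (lt_trans ex xy).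
nra.
Qed.
End Sigmoidal.

Theorem theorem8 (R : realType) (n : nat) (A : 'M[R]_n) (pi_ : R)
    (psi : 'I_n -> R -> R) (xplus : 'cV[R]_n)
    (A_nonneg : nonneg_mx A)
    (A_irreducible : irreducible_mx A)
    (A_symmetrizable : diag_symmetrizable A)
    (A_diag : null_diagonal A)
    (pi_gt1 : 1 < pi_)
    (psi_sigmoidal : forall i, sigmoidal (psi i))
    (psi_identical : forall i j xi, psi i xi = psi j xi)
    (xplus_pos : pos_orthant xplus)
    (xplus_neq0 : xplus != 0)
    (xplus_eq : equilibrium (vector_field A pi_ psi) xplus) :
  forall (K : set 'cV[R]_n) (xbar : 'cV[R]_n),
    is_orthant K -> K <> @pos_orthant R n -> K <> @neg_orthant R n ->
    K xbar -> equilibrium (vector_field A pi_ psi) xbar ->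
    euclidean_norm xbar <= euclidean_norm xplus.
Proof.
move=> K xbar _ _ _ _ xbar_eq.
have d0 i := irreducible_row_sum_gt0 i A_nonneg A_diag A_irreducible.
have [q xq0] : exists q, xplus q 0 != 0.
  apply/not_existsP => x0; move/eqP: xplus_neq0; apply.
  by apply/colP => i; rewrite mxE; apply/eqP/negPn/negP/x0.
pose f := psi q; have sf : sigmoidal f by exact: psi_sigmoidal.
have fE x : equilibrium (vector_field A pi_ psi) x -> forall i,
    (\sum_(j < n) A i j) * x i 0 = pi_ * \sum_(j < n) A i j * f (x j 0).
  move=> /(equilibriumE d0) E i; rewrite E; congr (_ * _).
  by apply: eq_bigr => j _; rewrite (psi_identical j q).
have {xbar_eq} Ebar := fE _ xbar_eq; have {xplus_eq} Eplus := fE _ xplus_eq.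
have pi0 : 0 < pi_ by lra.
have xp0 i : 0 <= xplus i 0 by have := xplus_pos i; rewrite mul1r.
(* The zero set of [xplus] is closed: where [xplus a 0 = 0], the nonnegative terms
   [A a j * f (xplus j 0)] sum to zero, so [A a b = 0] whenever [xplus b 0] is positive. *)
have xp_gt0 i : 0 < xplus i 0.
  rewrite lt_def xp0 andbT; apply/eqP => xi0; apply: A_irreducible.
  apply: (@reducible_closed_set _ _ _ [set j | xplus j 0 == 0] i q).
  - by rewrite inE xi0.
  - by rewrite inE.
  move=> a b; rewrite !inE => /eqP xa0 xb0.
  have t0 j : 0 <= A a j * f (xplus j 0).
    by rewrite mulr_ge0// -(sigmoidal0 sf) sigmoidal_le.
  move/eqP: (Eplus a); rewrite xa0 mulr0 eq_sym mulf_eq0 (gt_eqF pi0) /=.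
  rewrite psumr_eq0// => /allP/(_ b (mem_index_enum _)) /=.
  rewrite mulf_eq0 => /orP[/eqP//|].
  by rewrite gt_eqF// sigmoidal_gt0// lt_def xb0 xp0.
pose a := [arg max_(i > q) `|xbar i 0|]%O.
have aM j : `|xbar j 0| <= `|xbar a 0|.
  by rewrite /a; case: Order.TotalTheory.arg_maxP => // i _ Hi; exact: Hi.
pose b := [arg min_(i < q) xplus i 0]%O.
have bm j : xplus b 0 <= xplus j 0.
  by rewrite /b; case: Order.TotalTheory.arg_minP => // i _ Hi; exact: Hi.
(* Row [a] of the equilibrium equation, bounded by the triangle inequality and [f] at the maximum;
   the row sum then cancels. *)
have fM : `|xbar a 0| <= pi_ * f `|xbar a 0|.
  rewrite -(ler_pM2l (d0 a)) -[X in X * _ <= _]gtr0_norm// -normrM Ebar.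
  rewrite normrM gtr0_norm// mulrCA ler_pM2l// mulr_suml.
  rewrite (le_trans (ler_norm_sum _ _ _))// ler_sum// => j _.
  by rewrite normrM ger0_norm// (sigmoidal_norm sf) ler_wpM2l// sigmoidal_le.
have fm : pi_ * f (xplus b 0) <= xplus b 0.
  rewrite -(ler_pM2l (d0 b)) Eplus mulrCA ler_pM2l// mulr_suml.
  by rewrite ler_sum// => j _; rewrite ler_wpM2l// sigmoidal_le.
have Mm : `|xbar a 0| <= xplus b 0.
  rewrite leNgt; apply/negP => mM.
  have m0 := xp_gt0 b; have M0 := lt_trans m0 mM.
  (* With M and m the two extremes, m (pi f(M)) < M (pi f(m)) <= M m <= m (pi f(M)), a
     contradiction. *)
  have := sigmoidal_slope_lt sf m0 mM; rewrite -(ltr_pM2l pi0).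
  by rewrite mulrCA [ltRHS]mulrCA; nra.
rewrite /euclidean_norm ler_wsqrtr// ler_sum// => i _.
rewrite -real_normK ?num_real// ler_pXn2r ?nnegrE//.
exact: le_trans (aM i) (le_trans Mm (bm i)).
Qed.
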